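(* Let $0<\alpha<1$. (i) Let $1<p\le q<\frac{1}{\alpha}$, and set $s=\frac{p}{1-\alpha q}$ and $t=\frac{qs}{p}$. Then $\mathcal{M}_\alpha x\in l^s_t$ for every $x\in l^p_q$, and there exists a positive constant $C$, independent of $x$, such that $$\|\mathcal{M}_\alpha x\|_{l^s_t}\le C\|x\|_{l^p_q}\qquad\text{for all }x\in l^p_q.$$ (ii) If $x\in l^1$, then $\mathcal{M}_\alpha x\in l^{\frac{1}{1-\alpha},weak}$, and for every $\lambda>0$ there exists a positive constant $C$ such that for every $x\in l^1$, $$\left|\{k\in\mathbb{Z}:\mathcal{M}_\alpha x(k)>\lambda\}\right|\le C\left(\frac{\|x\|_{l^1}}{\lambda}\right)^{\frac{1}{1-\alpha}}.$$
   Context: Sequences are real, $x=\{x(k)\}_{k\in\mathbb{Z}}\subset\mathbb{R}$. $\mathbb{N}=\{0,1,2,\dots\}$. For $m\in\mathbb{Z}$, $N\in\mathbb{N}$, $S_{m,N}:=\{k\in\mathbb{Z}:|k-m|\le N\}$, and $|A|$ denotes cardinality of a set $A$ (so $|S_{m,N}|=2N+1$). Discrete Morrey space: for $1\le p\le q<\infty$, $l^p_q$ is the set of sequences $x$ with $$\|x\|_{l^p_q}:=\sup_{m\in\mathbb{Z},N\in\mathbb{N}}|S_{m,N}|^{\frac1q-\frac1p}\Big(\sum_{k\in S_{m,N}}|x(k)|^p\Big)^{\frac1p}<\infty .$$ $l^p$ is the usual space of $p$-summable sequences on $\mathbb{Z}$ with norm $\|x\|_{l^p}$. The weak space $l^{p,weak}$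 is the set of sequences with $\|x\|_{l^{p,weak}}:=\sup_{\lambda>0}\lambda\,|\{k\in\mathbb{Z}:|x(k)|>\lambda\}|^{1/p}<\infty$. Discrete fractional maximal operator: $\mathcal{M}_\alpha x(m):=\sup_{N\in\mathbb{N}}\frac{1}{|S_{m,N}|^{1-\alpha}}\sum_{k\in S_{m,N}}|x(k)|$, $m\in\mathbb{Z}$. *)

(* Defs.v *)
From HB Require Import structures.
From mathcomp Require Import all_boot all_order all_algebra.
From mathcomp Require Import finmap zify.
From mathcomp Require Import all_classical all_reals all_analysis.

Set Implicit Arguments.
Unset Strict Implicit.
Unset Printing Implicit Defensive.

Import Order.TTheory GRing.Theory Num.Theory.

Local Open Scope classical_set_scope.
Local Open Scope ring_scope.

Definition window (m : int) (N : nat) : set int :=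
  [set k : int | `|k - m| <= N%:Z].

Lemma window_image (m : int) (N : nat) :
  window m N = (fun i : nat => m - N%:Z + i%:Z) @` `I_(N.*2.+1).
Proof.
apply/seteqP; split => k; rewrite /window /=.
- move=> h; exists `|(k - m + N%:Z)%R|%N; lia.
- by case=> i /= hi <-; lia.
Qed.

Lemma finite_window (m : int) (N : nat) : finite_set (window m N).
Proof. by rewrite window_image; exact/finite_image/finite_II. Qed.

(* [fset_set] of an infinite set is empty; this is harmless here by
   [finite_window]. *)
Definition card_window (m : int) (N : nat) : nat :=
  #|` fset_set (window m N)|%fset.

Lemma card_windowE (m : int) (N : nat) : card_window m N = N.*2.+1.
Proof.
apply: card_fset_set; rewrite window_image.
by apply: inj_card_eq => i j _ _ /= ?; lia.
Qed.

Definition morrey_norm (R : realType) (p q : R) (x : int -> R) : \bar R :=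
  ereal_sup [set ((card_window mN.1 mN.2)%:R `^ (q^-1 - p^-1)
      * (\sum_(k \in window mN.1 mN.2) `|x k| `^ p) `^ p^-1)%:E
    | mN in [set: int * nat]].

Definition in_morrey (R : realType) (p q : R) (x : int -> R) : Prop :=
  (morrey_norm p q x < +oo)%E.

Definition lp_norm (R : realType) (p : R) (x : int -> R) : \bar R :=
  ((\esum_(k in [set: int]) (`|x k| `^ p)%:E) `^ p^-1)%E.

Definition in_lp (R : realType) (p : R) (x : int -> R) : Prop :=
  (lp_norm p x < +oo)%E.

Definition weak_lp_norm (R : realType) (p : R) (x : int -> R) : \bar R :=
  ereal_sup [set (l%:E * counting [set k : int | (l < `|x k|)%R] `^ p^-1)%E
    | l in [set l : R | 0 < l]].

Definition in_weak_lp (R : realType) (p : R) (x : int -> R) : Prop :=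
  (weak_lp_norm p x < +oo)%E.

(* Extended-real valued: the supremum is infinite for some sequences. *)
Definition frac_maximal (R : realType) (alpha : R) (x : int -> R) (m : int)
    : \bar R :=
  ereal_sup [set (((card_window m N)%:R `^ (1 - alpha))^-1
      * \sum_(k \in window m N) `|x k|)%:E | N in [set: nat]].

(* Main.v *)
(* The fractional average over a window with n points is n^alpha a, where a is
   the ordinary average. A Morrey bound gives n^(1/q) a <= K, and raising it to
   the power alpha q yields Hedberg's inequality
   n^alpha a <= K^(alpha q) a^(1 - alpha q), which reduces both parts to the
   Hardy-Littlewood maximal function (q = 1 for the weak type bound).

   On a finite interval the latter is dominated by its two one-sided versions,
   whose weak type bound lambda #{y >= lambda} <= sum of f over {y >= lambda}
   is the maximal ergodic lemma; summation over the values of y turns it into a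
   bound in l^p. For the Morrey norm one splits the averages around a window
   into those seen by the maximal function of the doubled window and those
   over longer windows, controlled directly by the Morrey bound. *)
Require Import Defs.
From mathcomp Require Import all_boot all_order all_algebra.
From mathcomp Require Import finmap zify ring lra.
From mathcomp Require Import all_classical all_reals all_analysis.
Import Order.TTheory GRing.Theory Num.Theory.
Local Open Scope classical_set_scope.
Local Open Scope ring_scope.
Set Implicit Arguments.
Unset Strict Implicit.

(** * The maximal ergodic lemma and the one-sided weak type bound *)

(** Induction on [n] with the starting point [j] free. If the last index is selected, its witness
    [k] serves as starting point when the left sum is empty. If it is not, every sum ending there is
    negative, while the right side is nonnegative by the case [j = n]. *)
Lemma maximal_ergodic (R : realDomainType) (a : nat -> R) (n j : nat) :
  (j <= n)%N ->
  \sum_(j <= l < n) a l <=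
  \sum_(i < n | [exists k : 'I_i.+1, 0 <= \sum_(k <= l < i.+1) a l]) a i.
Proof.
elim: n j => [|n IHn] j.
  by rewrite leqn0 => /eqP ->; rewrite big_geq // big_ord0.
rewrite leq_eqVlt ltnS [leRHS]big_mkcond big_ord_recr -big_mkcond /=.
case: ifPn => [/existsP [k hk]|/existsPn hn] /predU1P [->|jn].
- rewrite big_geq //; apply: (le_trans hk).
  by rewrite big_nat_recr -1?ltnS //= lerD2r IHn // -ltnS.
- by rewrite big_nat_recr //= lerD2r IHn.
- by rewrite big_geq // addr0; have := IHn _ (leqnn n); rewrite big_geq.
- have := hn (Ordinal (jn : (j < n.+1)%N)); rewrite -ltNge => /ltW /le_trans; apply.
  by rewrite addr0; have := IHn _ (leqnn n); rewrite big_geq.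
Qed.

Definition left_maximal (R : realType) (f : nat -> R) (i : nat) : R :=
  \big[Num.max/0]_(j < i.+1) ((\sum_(j <= l < i.+1) f l) / (i.+1 - j)%:R).

Lemma left_maximal_ge0 (R : realType) (f : nat -> R) (i : nat) :
  0 <= left_maximal f i.
Proof.
exact: bigmax_ge_id.
Qed.

(** An average is at least [lambda] exactly when [f - lambda] has a nonnegative sum over the same
    interval, so the maximal ergodic lemma applies to [f - lambda]. *)
Lemma left_maximal_weak (R : realType) (f : nat -> R) (n : nat) (lambda : R) :
  0 < lambda ->
  lambda * \sum_(i < n | lambda <= left_maximal f i) 1 <=
  \sum_(i < n | lambda <= left_maximal f i) f i.
Proof.
move=> l0; have := @maximal_ergodic R (fun l => f l - lambda) n n (leqnn n).
rewrite big_geq //; under eq_bigl => i.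
  have -> : [exists k : 'I_i.+1, 0 <= \sum_(k <= l < i.+1) (f l - lambda)]
      = (lambda <= left_maximal f i).
    have E (k : 'I_i.+1) : (0 <= \sum_(k <= l < i.+1) (f l - lambda))
      = (lambda <= (\sum_(k <= l < i.+1) f l) / (i.+1 - k)%:R).
      rewrite big_split /= sumr_const_nat mulNrn subr_ge0 ler_pdivlMr ?mulr_natr //.
      by rewrite ltr0n subn_gt0.
    apply/existsP/bigmax_geP => [[k]|[]].
    - by rewrite E => ?; right; exists k.
    (* The default 0 of the maximum cannot reach a positive [lambda]. *)
    - by move=> /(lt_le_trans l0); rewrite ltxx.
    - by move=> [k _ ?]; exists k; rewrite E.
  over.
by rewrite big_split /= sumrN subr_ge0 mulr_sumr mulr1.
Qed.

(** * From weak type to strong type bounds on a finite set *)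

(** Young's inequality for [b] and [a^(p-1)] with exponents [p] and [p / (p - 1)]. When [a <= b] it
    is the integral of [(p-1) t^(p-1) <= (p-1) b t^(p-2)] over [[a, b]]. *)
Lemma layer_increment (R : realType) (p a b : R) :
  1 < p -> 0 <= a -> 0 <= b ->
  (p - 1) / p * (b `^ p - a `^ p) <= b * (b `^ (p - 1) - a `^ (p - 1)).
Proof.
move=> p1 a0 b0; have p0 : 0 < p by lra.
have q0 : 0 < p / (p - 1) by rewrite divr_gt0 ?subr_gt0.
have pq : p^-1 + (p / (p - 1))^-1 = 1 by field; rewrite !gt_eqF //; lra.
have := conjugate_powR b0 (powR_ge0 a (p - 1)) p0 q0 pq.
rewrite -powRrM (_ : (p - 1) * (p / (p - 1)) = p); last by field; lra.
rewrite [X in _ -> _ <= X]mulrBr mulr_powRB1 //.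
rewrite invf_div (_ : (p - 1) / p = 1 - p^-1); last by field; lra.
lra.
Qed.

(** Replaces the integration of the weak type bound in [lambda] by a finite summation over the
    values of [y]. The induction is on the number of indices with [y] above [v]. *)
Lemma layer_cake_above (R : realType) (I : finType) (f y : I -> R) (p : R) :
  1 < p ->
  (forall lambda, 0 < lambda ->
    lambda * \sum_(i | lambda <= y i) 1 <= \sum_(i | lambda <= y i) f i) ->
  forall v, 0 <= v ->
    (p - 1) / p * \sum_(i | v < y i) (y i `^ p - v `^ p) <=
    \sum_(i | v < y i) f i * (y i `^ (p - 1) - v `^ (p - 1)).
Proof.
move=> p1 weak v; have [m] := ubnP #|[pred i | v < y i]|.
elim: m v => // m IHm v; rewrite ltnS => cardm v0.
case: (pickP [pred i | v < y i]) => [i0 vi0|none]; last first.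
  by rewrite !big_pred0 // mulr0.
case: (@Order.TotalTheory.arg_minP _ _ _ i0 [pred i | v < y i] y vi0) => i1 /= vi1 ymin.
(* No value of [y] lies strictly between [v] and [w], so [v < y i] and [w <= y i] select the same
   indices. *)
set w := y i1 in vi1 ymin.
have w0 : 0 < w by exact: le_lt_trans vi1.
have predE i : (v < y i) = (w <= y i).
  by apply/idP/idP => [/ymin //|]; exact: lt_le_trans.
(* Abel summation: lowering the base level from [w] to [v] adds the mass of [{w <= y}] times the
   increment of [h]; the terms with [y i = w] vanish. *)
have split_sum (g : I -> R) (h : R -> R) : \sum_(i | v < y i) g i * (h (y i) - h v)
    = \sum_(i | w < y i) g i * (h (y i) - h w)
      + (\sum_(i | w <= y i) g i) * (h w - h v).
  rewrite mulr_suml (eq_bigl _ _ predE) [X in _ = X + _](_ : _ =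
    \sum_(i | w <= y i) g i * (h (y i) - h w)); last first.
    rewrite big_mkcond [RHS]big_mkcond; apply: eq_bigr => i _.
    by case: ltgtP => // ->; rewrite subrr mulr0.
  by rewrite -big_split /=; apply: eq_bigr => i _; ring.
have IH : (p - 1) / p * \sum_(i | w < y i) (y i `^ p - w `^ p) <=
    \sum_(i | w < y i) f i * (y i `^ (p - 1) - w `^ (p - 1)).
  apply: IHm; last exact: ltW.
  apply: leq_trans cardm; apply: proper_card; apply/properP; split.
    by apply/fintype.subsetP => i; rewrite !inE; exact: lt_trans.
  by exists i1; rewrite !inE ?ltxx.
have := split_sum (fun=> 1) (fun z => z `^ p).
rewrite (eq_bigr _ (fun i _ => mul1r _)) => ->.
rewrite [in X in _ * (X + _)](eq_bigr _ (fun i _ => mul1r _)).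
rewrite (split_sum f (fun z => z `^ (p - 1))) mulrDr lerD //.
(* [layer_increment] between the levels [v] and [w], then the weak type bound at level [w]. *)
rewrite mulrCA; apply: le_trans (_ : _ <= (\sum_(i | w <= y i) 1) * (w * _)) _.
  rewrite ler_wpM2l ?sumr_ge0 //; apply: layer_increment => //; exact: ltW.
rewrite mulrA [_ * w]mulrC ler_wpM2r ?weak // subr_ge0.
by rewrite ge0_ler_powR ?nnegrE ?subr_ge0 // ltW.
Qed.

(** The layer cake bound at level 0 gives [(p-1)/p * sum y^p <= sum f y^(p-1)]. Splitting each term
    according to whether [A * f <= y] replaces Hölder's inequality; [A^-1] is half of [(p-1)/p], so
    the [y^p] term is absorbed on the left. *)
Lemma strong_type_of_weak (R : realType) (I : finType) (f y : I -> R) (p : R) :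
  1 < p -> (forall i, 0 <= f i) -> (forall i, 0 <= y i) ->
  (forall lambda, 0 < lambda ->
    lambda * \sum_(i | lambda <= y i) 1 <= \sum_(i | lambda <= y i) f i) ->
  \sum_i y i `^ p <= (2 * p / (p - 1)) `^ p * \sum_i f i `^ p.
Proof.
move=> p1 f0 y0 weak; set A := 2 * p / (p - 1).
have A0 : 0 < A by rewrite divr_gt0 ?subr_gt0 //; lra.
have := layer_cake_above p1 weak (lexx 0).
rewrite !powR0 ?gt_eqF ?subr_gt0 //; last by lra.
have drop (g : R -> R) (h : I -> R) : g 0 = 0 ->
    \sum_(i | 0 < y i) h i * (g (y i) - 0) = \sum_i h i * g (y i).
  move=> g0; rewrite big_mkcond; apply: eq_bigr => i _; rewrite subr0.
  by case: ltgtP (y0 i) => // <-; rewrite g0 mulr0.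
rewrite (drop (fun z => z `^ (p - 1)) f) ?powR0 ?gt_eqF ?subr_gt0 //.
have := drop (fun z => z `^ p) (fun=> 1); rewrite powR0; last by rewrite gt_eqF; lra.
move=> /(_ erefl); rewrite !(eq_bigr _ (fun i _ => mul1r _)) => -> ineq.
have pt i : f i * y i `^ (p - 1) <=
    A `^ (p - 1) * f i `^ p + A^-1 * y i `^ p.
  have [fy|yf] := leP (A * f i) (y i).
    rewrite ler_wpDl ?mulr_ge0 ?powR_ge0 //.
    rewrite -[y i `^ p]mulr_powRB1 //; last lra.
    by rewrite mulrA ler_wpM2r ?powR_ge0 // mulrC ler_pdivlMr // mulrC.
  rewrite ler_wpDr ?mulr_ge0 ?powR_ge0 ?invr_ge0 ?(ltW A0) //.
  rewrite -[f i `^ p]mulr_powRB1 //; last lra.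
  rewrite mulrCA ler_wpM2l // -powRM ?(ltW A0) //.
  by rewrite ge0_ler_powR ?nnegrE ?subr_ge0 ?(mulr_ge0 (ltW A0) (f0 i)) ?(ltW p1) ?(ltW yf).
have := @ler_sum _ _ (index_enum I) xpredT _ _ (fun i _ => pt i).
rewrite big_split /= -!mulr_sumr => /(le_trans ineq).
rewrite -[A `^ p]mulr_powRB1; [|exact: ltW|lra].
have -> : (p - 1) / p = 2 * A^-1 by rewrite /A; field; apply/andP; split; lra.
rewrite -mulrA -lerBlDr -mulrBl (_ : 2 * A^-1 - A^-1 = A^-1); last ring.
by rewrite ler_pdivrMl.
Qed.

Lemma left_maximal_strong (R : realType) (f : nat -> R) (n : nat) (p : R) :
  1 < p -> (forall i, 0 <= f i) ->
  \sum_(i < n) left_maximal f i `^ p <=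
  (2 * p / (p - 1)) `^ p * \sum_(i < n) f i `^ p.
Proof.
move=> p1 f0.
apply: (@strong_type_of_weak _ 'I_n (fun i => f i) (fun i => left_maximal f i)) => // [i|].
  exact: left_maximal_ge0.
by move=> lambda; exact: left_maximal_weak.
Qed.

(** * From one-sided to centred averages on a finite interval *)

Lemma le_left_maximal (R : realType) (f : nat -> R) (i j : nat) :
  (j <= i)%N ->
  \sum_(j <= l < i.+1) f l <= (i.+1 - j)%:R * left_maximal f i.
Proof.
rewrite -ltnS => ji; rewrite mulrC -ler_pdivrMr ?ltr0n ?subn_gt0 //.
exact: (@le_bigmax _ _ _ 0 (fun j : 'I_i.+1 => (\sum_(j <= l < i.+1) f l) / (i.+1 - j)%:R)
  (Ordinal ji)).
Qed.

(** The second summand is the maximal function over the intervals that start at [i], obtained by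
    reflecting [0, ..., n - 1]. *)
Definition two_sided_maximal (R : realType) (n : nat) (f : nat -> R) (i : nat) : R :=
  left_maximal f i + left_maximal (fun l => f (n - l.+1)%N) (n - i.+1).

Lemma two_sided_maximal_ge0 (R : realType) (n : nat) (f : nat -> R) (i : nat) :
  0 <= two_sided_maximal n f i.
Proof. by rewrite addr_ge0 ?left_maximal_ge0. Qed.

Lemma le_two_sided_maximal (R : realType) (n : nat) (f : nat -> R) (i r : nat) :
  (forall l, 0 <= f l) -> (r <= i)%N -> (i + r < n)%N ->
  (\sum_(0 <= l < r.*2.+1) f (i - r + l)%N) / r.*2.+1%:R <= two_sided_maximal n f i.
Proof.
move=> f0 ri irn; set g := fun l => f (n - l.+1)%N.
have L := le_left_maximal f (leq_subr r i).
have G := le_left_maximal g (leq_subr r (n - i.+1)).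
have rin : (r <= n - i.+1)%N by lia.
rewrite subSn ?leq_subr // subKn // in L; rewrite subSn ?leq_subr // subKn // in G.
have sumL : \sum_(i - r <= l < i.+1) f l = \sum_(0 <= l < r.+1) f (i - r + l)%N.
  rewrite -{1}[(i - r)%N]add0n big_addn (_ : (i.+1 - (i - r) = r.+1)%N); last lia.
  by apply: eq_bigr => l _; rewrite addnC.
have sumG : \sum_(n - i.+1 - r <= l < (n - i.+1).+1) g l
    = \sum_(0 <= l < r.+1) f (i - r + (r + l))%N.
  rewrite -{1}[(n - i.+1 - r)%N]add0n big_addn big_nat_rev.
  rewrite (_ : ((n - i.+1).+1 - (n - i.+1 - r) = r.+1)%N); last lia.
  rewrite big_nat [RHS]big_nat; apply: eq_bigr => l lr; rewrite /g; congr f; lia.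
rewrite ler_pdivrMr ?ltr0n //.
have -> : \sum_(0 <= l < r.*2.+1) f (i - r + l)%N
  = \sum_(0 <= l < r) f (i - r + l)%N + \sum_(0 <= l < r.+1) f (i - r + (r + l))%N.
  rewrite (@big_cat_nat _ _ _ r) //=; last by lia.
  congr (_ + _); rewrite -{1}[r]add0n big_addn (_ : (r.*2.+1 - r = r.+1)%N); last lia.
  by apply: eq_bigr => l _; rewrite [(l + r)%N]addnC.
(* The centre belongs to the right half only. Adding it to the left half gives both [r + 1] points,
   and [r + 1 <= 2 * r + 1]. *)
apply: (@le_trans _ _ (r.+1%:R * two_sided_maximal n f i)).
  rewrite mulrDr lerD //; last by rewrite -sumG.
  by apply: le_trans L; rewrite sumL [leRHS]big_nat_recr //= lerDl f0.
by rewrite mulrC ler_wpM2l ?two_sided_maximal_ge0 // ler_nat; lia.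
Qed.

Lemma sum_rev_ord (R : realType) (n : nat) (g : nat -> R) :
  \sum_(i < n) g (n - i.+1)%N = \sum_(i < n) g i.
Proof. by rewrite [RHS](reindex_inj rev_ord_inj). Qed.

Lemma powRD_le (R : realType) (p a b : R) : 0 <= p -> 0 <= a -> 0 <= b ->
  (a + b) `^ p <= 2 `^ p * (a `^ p + b `^ p).
Proof.
move=> p0; wlog ab : a b / a <= b => [hwlog a0 b0|a0 b0].
  have [/hwlog|/ltW/hwlog] := leP a b; first exact.
  by rewrite addrC [b `^ p + _]addrC; exact.
apply: (@le_trans _ _ ((2 * b) `^ p)).
  by rewrite ge0_ler_powR ?nnegrE //; lra.
by rewrite powRM // ler_wpM2l ?powR_ge0 // lerDr powR_ge0.
Qed.

Lemma two_sided_maximal_strong (R : realType) (f : nat -> R) (n : nat) (p : R) :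
  1 < p -> (forall i, 0 <= f i) ->
  \sum_(i < n) two_sided_maximal n f i `^ p <=
  2 `^ p * (2 * (2 * p / (p - 1)) `^ p) * \sum_(i < n) f i `^ p.
Proof.
move=> p1 f0; set c := (_ / _) `^ p.
apply: (@le_trans _ _ (2 `^ p * (\sum_(i < n) left_maximal f i `^ p +
  \sum_(i < n) left_maximal (fun l => f (n - l.+1)%N) i `^ p))).
  rewrite -[X in _ * (_ + X)](sum_rev_ord n (fun i => left_maximal _ i `^ p)).
  rewrite -big_split mulr_sumr ler_sum //= => i _.
  by rewrite powRD_le ?left_maximal_ge0 //; lra.
rewrite -mulrA ler_wpM2l ?powR_ge0 // -mulrA mulr2n mulrDl mul1r lerD //.
  exact: left_maximal_strong.
rewrite -(sum_rev_ord n (fun i => f i `^ p)).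
exact: left_maximal_strong.
Qed.

(** Where the two-sided function reaches [lambda], one of its summands reaches [lambda / 2]; two
    one-sided bounds at level [lambda / 2] give the factor 4. *)
Lemma two_sided_maximal_weak (R : realType) (f : nat -> R) (n : nat) (lambda : R) :
  0 < lambda -> (forall i, 0 <= f i) ->
  lambda * \sum_(i < n | lambda <= two_sided_maximal n f i) 1 <=
  4 * \sum_(i < n) f i.
Proof.
move=> l0 f0.
have one_sided (g : nat -> R) : (forall i, 0 <= g i) ->
    lambda / 2 * \sum_(i < n | lambda / 2 <= left_maximal g i) 1 <= \sum_(i < n) g i.
  move=> g0; apply: (le_trans (left_maximal_weak g n _)); first by lra.
  by rewrite [leLHS]big_mkcond ler_sum // => i _; case: ifP.
have := one_sided _ f0; have := one_sided (fun l => f (n - l.+1)%N) (fun=> f0 _).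
rewrite (sum_rev_ord n f) [X in _ * X <= _]big_mkcond.
rewrite -(sum_rev_ord n (fun i => if _ <= left_maximal _ i then 1 else 0)) /=.
rewrite [X in _ -> _ * X <= _ -> _]big_mkcond => hr hl.
rewrite [X in _ * X]big_mkcond.
have : \sum_(i < n) (if lambda <= two_sided_maximal n f i then 1 else 0 : R) <=
  \sum_(i < n) (if lambda / 2 <= left_maximal f i then 1 else 0) +
  \sum_(i < n) (if lambda / 2 <= left_maximal (fun l => f (n - l.+1)%N) (n - i.+1)
    then 1 else 0).
  rewrite -big_split ler_sum //= => i _; rewrite /two_sided_maximal.
  by case: (leP lambda) => ?; do 2 (case: (leP (lambda / 2)) => ?); lra.
move=> /(ler_wpM2l (ltW l0)); rewrite mulrDr; lra.
Qed.

(** * Averages over windows and Hedberg's inequality *)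

(** With [a] the mean, Young's inequality for [f i] and [a^(p-1)] is the tangent line bound of [t^p]
    at [a]; it is summed over [i]. *)
Lemma power_mean (R : realType) (n : nat) (f : nat -> R) (p : R) :
  1 < p -> (0 < n)%N -> (forall i, 0 <= f i) ->
  ((\sum_(i < n) f i) / n%:R) `^ p <= (\sum_(i < n) f i `^ p) / n%:R.
Proof.
move=> p1 n0 f0; set a := _ / n%:R.
have nR : 0 < n%:R :> R by rewrite ltr0n.
have a0 : 0 <= a by rewrite divr_ge0 ?ler0n // sumr_ge0.
have p0 : 0 < p by lra.
have q0 : 0 < p / (p - 1) by rewrite divr_gt0 ?subr_gt0.
have pq : p^-1 + (p / (p - 1))^-1 = 1 by field; rewrite !gt_eqF //; lra.
have young (i : 'I_n) : f i * a `^ (p - 1) <= f i `^ p / p + a `^ p * (1 - p^-1).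
  have := conjugate_powR (f0 i) (powR_ge0 a (p - 1)) p0 q0 pq.
  rewrite -powRrM (_ : (p - 1) * (p / (p - 1)) = p); last by field; lra.
  by rewrite invf_div (_ : (p - 1) / p = 1 - p^-1) //; field; lra.
have := @ler_sum _ _ (index_enum 'I_n) xpredT _ _ (fun i _ => young i).
rewrite -mulr_suml big_split /= -mulr_suml sumr_const card_ord -[X in _ <= _ + X -> _]mulr_natl.
have -> : \sum_(i < n) f i = n%:R * a by rewrite mulrC divfK ?gt_eqF.
rewrite -mulrA mulr_powRB1 // => h.
have ip : 0 < p^-1 by rewrite invr_gt0.
rewrite (ler_pdivlMr _ _ nR).
suff : a `^ p * n%:R * p^-1 <= (\sum_(i < n) f i `^ p) * p^-1 by rewrite ler_pM2r.
lra.
Qed.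

Lemma window_sum (R : realType) (m : int) (N : nat) (F : int -> R) :
  \sum_(k \in window m N) F k = \sum_(i < N.*2.+1) F (m - N%:Z + i%:Z).
Proof.
rewrite window_image fsbig_image; last by move=> i j _ _ /=; lia.
by rewrite (fsbig_ord _ _ (fun i : nat => F (m - N%:Z + i%:Z))).
Qed.

Definition window_average (R : realType) (x : int -> R) (m : int) (N : nat) : R :=
  (\sum_(i < N.*2.+1) `|x (m - N%:Z + i%:Z)|) / N.*2.+1%:R.

Lemma window_average_ge0 (R : realType) (x : int -> R) (m : int) (N : nat) :
  0 <= window_average x m N.
Proof. by rewrite divr_ge0 // sumr_ge0. Qed.

Lemma frac_maximalE (R : realType) (alpha : R) (x : int -> R) (m : int) :
  frac_maximal alpha x m =
  ereal_sup [set (N.*2.+1%:R `^ alpha * window_average x m N)%:E | N in [set: nat]].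
Proof.
congr ereal_sup; apply: eq_imagel => N _; congr EFin.
rewrite window_sum card_windowE powRB ?pnatr_eq0 ?implybT // powRr1 //.
rewrite /window_average; field; rewrite gt_eqF ?powR_gt0 ?ltr0n //=.
Qed.

Lemma frac_maximal_ge0 (R : realType) (alpha : R) (x : int -> R) (m : int) : (0 <= frac_maximal alpha x m)%E.
Proof.
rewrite frac_maximalE; apply: ereal_sup_ge; exists (1%:R `^ alpha * window_average x m 0)%:E.
  by exists 0%N.
by rewrite lee_fin mulr_ge0 ?powR_ge0 ?window_average_ge0.
Qed.

(** Hedberg's inequality: [a] splits into [a^(alpha q) * a^(1 - alpha q)], and the first factor
    joins [n^alpha = (n^(1/q))^(alpha q)]. *)
Lemma fractional_average_le (R : realType) (alpha q n a K : R) :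
  0 < alpha -> 0 < q -> 0 <= n -> 0 <= a -> n `^ q^-1 * a <= K ->
  n `^ alpha * a <= K `^ (alpha * q) * a `^ (1 - alpha * q).
Proof.
move=> al0 q0 n0 a0 aK.
have -> : n `^ alpha * a = n `^ alpha * a `^ (alpha * q) * a `^ (1 - alpha * q).
  by rewrite -mulrA -powRD ?subrKC ?powRr1 ?oner_eq0.
rewrite ler_wpM2r ?powR_ge0 //.
have -> : n `^ alpha = (n `^ q^-1) `^ (alpha * q).
  by rewrite -powRrM mulrCA mulVf ?mulr1 // gt_eqF.
have K0 : 0 <= K by apply: le_trans aK; rewrite mulr_ge0 ?powR_ge0.
rewrite -powRM ?powR_ge0 // ge0_ler_powR ?nnegrE ?mulr_ge0 ?powR_ge0 //; exact: ltW.
Qed.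

Lemma window_average_le_two_sided (R : realType) (x : int -> R) (m : int) (L i r : nat) :
  (r <= i)%N -> (i + r < L.*2.+1)%N ->
  window_average x (m - L%:Z + i%:Z) r <=
  two_sided_maximal L.*2.+1 (fun l => `|x (m - L%:Z + l%:Z)|) i.
Proof.
move=> ri irL; apply: le_trans (le_two_sided_maximal _ ri irL) => //.
rewrite big_mkord /window_average ler_wpM2r ?invr_ge0 // le_eqVlt; apply/orP; left.
apply/eqP/eq_bigr => l _; congr (`|x _|); lia.
Qed.

(** * The fractional maximal operator under a Morrey bound *)

Section MorreyBound.
Variables (R : realType) (p q K : R) (x : int -> R).
Hypotheses (p1 : 1 < p) (pq : p <= q) (K0 : 0 <= K).
(** The bound [morrey_norm p q x <= K] raised to the power [p], with the power of the window size
    moved to the right. *)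
Hypothesis xK : forall m N,
  \sum_(i < N.*2.+1) `|x (m - N%:Z + i%:Z)| `^ p <= N.*2.+1%:R `^ (1 - p / q) * K `^ p.

(** [power_mean] bounds the [p]-th power of the average by [n^(-p/q) * K^p], with [n] the window
    size. *)
Lemma morrey_average_le m N : N.*2.+1%:R `^ q^-1 * window_average x m N <= K.
Proof.
have p0 : 0 < p := lt_trans ltr01 p1.
have q0 : 0 < q := lt_le_trans (lt_trans ltr01 p1) pq.
have n0 : 0 < N.*2.+1%:R :> R by rewrite ltr0n.
have h : window_average x m N `^ p <= N.*2.+1%:R `^ (- (p / q)) * K `^ p.
  apply: (le_trans (@power_mean _ _ (fun i => `|x (m - N%:Z + i%:Z)|) _ p1 (ltn0Sn _) _)) => //.
  rewrite ler_pdivrMr // mulrAC -[X in _ <= _ * X * _]powRr1 ?ler0n //.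
  rewrite -powRD; last by rewrite pnatr_eq0 implybT.
  by rewrite [- _ + 1]addrC.
have {}h : (N.*2.+1%:R `^ q^-1 * window_average x m N) `^ p <= K `^ p.
  rewrite powRM ?powR_ge0 ?window_average_ge0 // -powRrM.
  have -> : K `^ p = N.*2.+1%:R `^ (p / q) * (N.*2.+1%:R `^ (- (p / q)) * K `^ p).
    by rewrite mulrA -powRD ?subrr ?powRr0 ?mul1r // pnatr_eq0 implybT.
  by rewrite [q^-1 * p]mulrC ler_wpM2l ?powR_ge0.
rewrite leNgt; apply/negP => /(gt0_ltr_powR p0); rewrite !nnegrE K0.
by rewrite mulr_ge0 ?powR_ge0 ?window_average_ge0 // ltNge h => /(_ isT isT).
Qed.

(** Position [j] in the window of radius [N] is position [N + j] in the doubled window, which leaves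
    room for radii up to [N] on both sides. *)
Let local_maximal m N (j : nat) : R :=
  two_sided_maximal (N.*2).*2.+1 (fun l => `|x (m - (N.*2)%:Z + l%:Z)|) (N + j)%N.

(* Windows of radius at most N are seen by the maximal function of the doubled
   window, the larger ones are controlled by the Morrey bound. *)
Lemma window_average_le m N j r : (j < N.*2.+1)%N ->
  window_average x (m - N%:Z + j%:Z) r <=
  local_maximal m N j + N.*2.+1%:R `^ (- q^-1) * K.
Proof.
move=> jN; have q0 : 0 < q := lt_le_trans (lt_trans ltr01 p1) pq.
have [rN|Nr] := leqP r N.
  apply: ler_wpDr; first by rewrite mulr_ge0 ?powR_ge0.
  have -> : m - N%:Z + j%:Z = m - (N.*2)%:Z + (N + j)%N%:Z by lia.
  by apply: window_average_le_two_sided; lia.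
apply: ler_wpDl; first exact: two_sided_maximal_ge0.
rewrite powRN mulrC ler_pdivlMr ?powR_gt0 ?ltr0n // mulrC.
apply: le_trans (morrey_average_le (m - N%:Z + j%:Z) r).
rewrite ler_wpM2r ?window_average_ge0 // ge0_ler_powR ?nnegrE ?invr_ge0 ?(ltW q0) //.
by rewrite ler_nat; lia.
Qed.

Definition hl_constant : R := 2 `^ p * (2 * (2 * p / (p - 1)) `^ p).

(** The factor [2 ^ p] comes from [powRD_le], the 2 from doubling the window, and the 1 from the
    averages over longer windows. *)
Definition morrey_constant : R := 2 `^ p * (hl_constant * 2 + 1).

Lemma morrey_local_maximal m N :
  \sum_(j < N.*2.+1) (local_maximal m N j + N.*2.+1%:R `^ (- q^-1) * K) `^ p <=
  morrey_constant * (N.*2.+1%:R `^ (1 - p / q) * K `^ p).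
Proof.
have p0 : 0 < p := lt_trans ltr01 p1.
have q0 : 0 < q := lt_le_trans (lt_trans ltr01 p1) pq.
set n := N.*2.+1.
have n0 : 0 < n%:R :> R by rewrite ltr0n.
have c0 : 0 <= hl_constant by rewrite !mulr_ge0 ?powR_ge0.
apply: (@le_trans _ _ (2 `^ p * \sum_(j < n) (local_maximal m N j `^ p
    + (n%:R `^ (- q^-1) * K) `^ p))).
  rewrite mulr_sumr ler_sum // => j _.
  by rewrite powRD_le ?(ltW p0) ?two_sided_maximal_ge0 ?mulr_ge0 ?powR_ge0.
rewrite -mulrA ler_wpM2l ?powR_ge0 // big_split mulrDl mul1r /= lerD //; last first.
  (* The constant term contributes [n * (n^(-1/q) * K)^p = n^(1-p/q) * K^p]. *)
  rewrite sumr_const card_ord -[leLHS]mulr_natl powRM ?powR_ge0 // mulrA ler_wpM2r ?powR_ge0 //.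
  rewrite -[X in X * _]powRr1 ?(ltW n0) // -powRrM -powRD ?pnatr_eq0 ?implybT //.
  by rewrite mulNr [q^-1 * p]mulrC.
(* The window of radius [N] occupies the middle [n] positions of the doubled one; the other terms
   are nonnegative. *)
have maximal_sum : \sum_(j < n) local_maximal m N j `^ p <=
    \sum_(i < (N.*2).*2.+1) two_sided_maximal (N.*2).*2.+1
      (fun l => `|x (m - (N.*2)%:Z + l%:Z)|) i `^ p.
  rewrite -!(big_mkord xpredT (fun i => _ i `^ p)) [leRHS](@big_cat_nat _ _ _ N) //=; last by lia.
  rewrite [X in _ + X](@big_cat_nat _ _ _ (N + n)) /=; [|lia|lia].
  rewrite -[X in \sum_(X <= i < N + n) _]add0n [X in _ + (X + _)]big_addn addKn.
  rewrite [X in _ + (X + _)](_ : _ = \sum_(0 <= j < n) local_maximal m N j `^ p); last first.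
    by apply: eq_bigr => j _; rewrite addnC.
  rewrite addrCA lerDl addr_ge0 // sumr_ge0 // => i _; exact: powR_ge0.
apply: (le_trans maximal_sum); apply: le_trans (two_sided_maximal_strong _ p1 _) _ => //.
rewrite -[leLHS]/(hl_constant * _) -mulrA ler_wpM2l //.
apply: (le_trans (xK m N.*2)); rewrite mulrA ler_wpM2r ?powR_ge0 //.
(* The doubled window has at most [2 * n] points and [0 <= 1 - p/q <= 1], so doubling costs at most
   a factor 2. *)
have e0 : 0 <= 1 - p / q by rewrite subr_ge0 ler_pdivrMr ?mul1r.
apply: (@le_trans _ _ ((2 * n%:R) `^ (1 - p / q))).
  rewrite ge0_ler_powR ?nnegrE ?mulr_ge0 ?ler0n // -natrM ler_nat /n; lia.
rewrite powRM ?(ltW n0) // ler_wpM2r ?powR_ge0 // ler1_powR ?ler1n //.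
by rewrite gerBl divr_ge0 ?ltW.
Qed.

Variables (alpha : R).
Hypotheses (alpha0 : 0 < alpha) (alphaq : alpha * q < 1).
Let s := p / (1 - alpha * q).

(** Hedberg's inequality combined with [window_average_le]; the bound does not depend on the radius
    and so passes to the supremum. *)
Lemma morrey_frac_maximal_le m N j : (j < N.*2.+1)%N ->
  (frac_maximal alpha x (m - N%:Z + j%:Z) <=
  (K `^ (alpha * q) * (local_maximal m N j + N.*2.+1%:R `^ (- q^-1) * K)
    `^ (1 - alpha * q))%:E)%E.
Proof.
move=> jN; rewrite frac_maximalE; apply: ge_ereal_sup => _ /= [r _ <-].
rewrite lee_fin; apply: le_trans (fractional_average_le alpha0 _ _ _ (morrey_average_le _ _)) _ => //.
- exact: lt_le_trans (lt_trans ltr01 p1) pq.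
- exact: window_average_ge0.
rewrite ler_wpM2l ?powR_ge0 // ge0_ler_powR ?nnegrE ?window_average_ge0 ?window_average_le //.
- by rewrite subr_ge0 ltW.
- by rewrite addr_ge0 ?two_sided_maximal_ge0 // mulr_ge0 ?powR_ge0.
Qed.

Lemma morrey_frac_maximal_fin_num m : frac_maximal alpha x m \is a fin_num.
Proof.
rewrite ge0_fin_numE ?frac_maximal_ge0 //.
have := @morrey_frac_maximal_le m 0 0 isT; rewrite subr0 addr0 => /le_lt_trans; apply.
exact: ltry.
Qed.

(** Since [(1 - alpha q) s = p], the power [s] of the pointwise bound contains the [p]-th power
    controlled by [morrey_local_maximal]. The powers of [K] add up because [alpha q s + p = s]. *)
Lemma morrey_frac_maximal_window m N :
  \sum_(k \in window m N) `|fine (frac_maximal alpha x k)| `^ s <=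
  morrey_constant * (N.*2.+1%:R `^ (1 - p / q) * K `^ s).
Proof.
have p0 : 0 < p := lt_trans ltr01 p1.
have r0 : 0 < 1 - alpha * q by rewrite subr_gt0.
have s0 : 0 < s by rewrite divr_gt0.
have -> : K `^ s = K `^ (alpha * q * s) * K `^ p.
  have E : alpha * q * s + p = s by rewrite /s; field; rewrite gt_eqF.
  by rewrite -powRD ?E // gt_eqF.
rewrite window_sum [X in _ <= _ * X]mulrCA [leRHS]mulrCA.
apply: le_trans (ler_wpM2l (powR_ge0 _ _) (morrey_local_maximal m N)).
rewrite mulr_sumr ler_sum // => j _.
have b0 : 0 <= local_maximal m N j + N.*2.+1%:R `^ (- q^-1) * K.
  by rewrite addr_ge0 ?two_sided_maximal_ge0 // mulr_ge0 ?powR_ge0.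
rewrite powRrM -[X in _ <= _ * _ `^ X](_ : (1 - alpha * q) * s = p); last by rewrite /s; field; rewrite gt_eqF.
rewrite [X in _ <= _ * X]powRrM -powRM ?powR_ge0 // ge0_ler_powR ?nnegrE ?(ltW s0) ?mulr_ge0 ?powR_ge0 //.
rewrite ger0_norm ?fine_ge0 ?frac_maximal_ge0 // -lee_fin fineK ?morrey_frac_maximal_fin_num //.
exact: morrey_frac_maximal_le.
Qed.

End MorreyBound.

Lemma morrey_norm_ge0 (R : realType) (p q : R) (x : int -> R) :
  (0 <= morrey_norm p q x)%E.
Proof.
apply: ereal_sup_ge; eexists; first by exists (0, 0%N).
by rewrite lee_fin mulr_ge0 ?powR_ge0.
Qed.

Lemma morrey_norm_window_sum (R : realType) (p q K : R) (x : int -> R) :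
  0 < p -> (morrey_norm p q x <= K%:E)%E -> forall m N,
  \sum_(i < N.*2.+1) `|x (m - N%:Z + i%:Z)| `^ p <= N.*2.+1%:R `^ (1 - p / q) * K `^ p.
Proof.
move=> p0 xK m N; set S := leLHS.
have S0 : 0 <= S by rewrite sumr_ge0 // => i _; exact: powR_ge0.
have h : N.*2.+1%:R `^ (q^-1 - p^-1) * S `^ p^-1 <= K.
  rewrite -lee_fin; apply: le_trans xK; apply: ereal_sup_ubound; exists (m, N) => //=.
  by rewrite window_sum card_windowE.
have K0 : 0 <= K by apply: le_trans h; rewrite mulr_ge0 ?powR_ge0.
have := ge0_ler_powR (ltW p0) _ _ h; rewrite !nnegrE K0 mulr_ge0 ?powR_ge0 //.
move=> /(_ isT isT); rewrite powRM ?powR_ge0 // -!powRrM mulVf ?gt_eqF // powRr1 //.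
move=> /(ler_wpM2l (powR_ge0 N.*2.+1%:R (1 - p / q))); apply: le_trans.
rewrite mulrA -powRD; last by rewrite pnatr_eq0 implybT.
rewrite (_ : 1 - p / q + (q^-1 - p^-1) * p = 0) ?powRr0 ?mul1r //.
by rewrite mulrBl mulVf ?gt_eqF // [q^-1 * p]mulrC; ring.
Qed.

(** With [t = q s / p] one has [s / t = p / q], so the powers of the window size cancel after taking
    [s]-th roots. *)
Lemma morrey_norm_frac_maximal_le (R : realType) (alpha p q s K : R) (x : int -> R) :
  0 < alpha -> 1 < p -> p <= q -> alpha * q < 1 -> 0 <= K ->
  (morrey_norm p q x <= K%:E)%E ->
  s = p / (1 - alpha * q) ->
  (morrey_norm s (q * s / p) (fine \o frac_maximal alpha x)
    <= (morrey_constant p `^ s^-1 * K)%:E)%E.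
Proof.
move=> al0 p1 pq alq K0 xK sE.
have p0 : 0 < p := lt_trans ltr01 p1.
have q0 : 0 < q := lt_le_trans p0 pq.
have s0 : 0 < s by rewrite sE divr_gt0 // subr_gt0.
apply: ge_ereal_sup => _ /= [[m N] _ <-]; rewrite lee_fin /= card_windowE.
have := morrey_frac_maximal_window p1 pq K0 (morrey_norm_window_sum p0 xK) al0 alq m N.
rewrite -sE; set S := leLHS => SK.
have S0 : 0 <= S by apply: fsumr_ge0 => k _; exact: powR_ge0.
have D0 : 0 <= morrey_constant p.
  by rewrite mulr_ge0 ?powR_ge0 // addr_ge0 // !mulr_ge0 ?powR_ge0.
have si0 : 0 <= s^-1 by rewrite invr_ge0 ltW.
have {}SK : S `^ s^-1 <= (morrey_constant p * (N.*2.+1%:R `^ (1 - p / q) * K `^ s)) `^ s^-1.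
  by rewrite ge0_ler_powR ?nnegrE // (mulr_ge0 D0) // mulr_ge0 ?powR_ge0.
move: SK; rewrite powRM // ?mulr_ge0 ?powR_ge0 // powRM ?powR_ge0 // -!powRrM mulfV ?gt_eqF // powRr1 // => SK.
apply: le_trans (ler_wpM2l (powR_ge0 _ _) SK) _.
rewrite mulrCA ler_wpM2l ?powR_ge0 // mulrA -powRD; last by rewrite pnatr_eq0 implybT.
rewrite (_ : _ + _ = 0) ?powRr0 ?mul1r //.
by field; rewrite !gt_eqF.
Qed.

(** * The weak type bound for summable sequences *)

Lemma frac_maximal_le_sum (R : realType) (alpha K : R) (x : int -> R) (m : int) :
  alpha < 1 ->
  (forall m N, \sum_(i < N.*2.+1) `|x (m - N%:Z + i%:Z)| <= K) ->
  (frac_maximal alpha x m <= K%:E)%E.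
Proof.
move=> al1 xK; apply: ge_ereal_sup => _ /= [N _ <-].
rewrite lee_fin window_sum card_windowE; apply: le_trans (xK m N).
rewrite ler_piMl ?sumr_ge0 // invf_le1 ?powR_gt0 ?ltr0n //.
by rewrite -[leLHS](powRr0 N.*2.+1%:R) ler_powR ?ler1n // subr_ge0 ltW.
Qed.

(** For a finite [B] one window per point suffices, and these windows all fit in one interval, where
    the two-sided weak type bound applies. *)
Lemma weak_type_fset (R : realType) (alpha K lambda : R) (x : int -> R) (B : {fset int}) :
  0 < alpha -> alpha < 1 -> 0 < lambda ->
  (forall m N, \sum_(i < N.*2.+1) `|x (m - N%:Z + i%:Z)| <= K) ->
  {in B, forall k, (lambda%:E < frac_maximal alpha x k)%E} ->
  #|` B|%:R <= 4 * (K / lambda) `^ (1 - alpha)^-1.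
Proof.
move=> al0 al1 l0 xK Bx.
have e0 : 0 < 1 - alpha by rewrite subr_gt0.
have [->|[k0 k0B]] := fset_0Vmem B; first by rewrite cardfs0 mulr_ge0 ?powR_ge0.
have {}Bx k : exists r, k \in B -> lambda < r.*2.+1%:R `^ alpha * window_average x k r.
  have [kB|_] := boolP (k \in B); last by exists 0%N.
  have := Bx _ kB; rewrite frac_maximalE => /ereal_sup_gt [_ [r _ <-]].
  by rewrite lte_fin; exists r.
have {Bx} [r Bx] := choice Bx.
(* The hypothesis of [fractional_average_le] for [q = 1]. *)
have avgK k N : N.*2.+1%:R `^ 1^-1 * window_average x k N <= K.
  by rewrite invr1 powRr1 // /window_average mulrCA divff ?pnatr_eq0 // mulr1.
have K0 : 0 < K.
  apply: lt_le_trans (avgK k0 (r k0)); rewrite mulr_gt0 ?powR_gt0 ?ltr0n // lt_neqAle.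
  rewrite window_average_ge0 andbT eq_sym; apply: contraTneq (Bx _ k0B) => ->.
  by rewrite mulr0 -leNgt ltW.
(* [mu] solves [K^alpha * mu^(1-alpha) = lambda]: Hedberg's inequality takes level [lambda] of the
   fractional averages to level [mu] of the ordinary ones. *)
pose mu := (lambda / K `^ alpha) `^ (1 - alpha)^-1.
have lK0 : 0 < lambda / K `^ alpha by rewrite divr_gt0 ?powR_gt0.
have mu0 : 0 < mu by rewrite powR_gt0.
have mu_avg k : k \in B -> mu <= window_average x k (r k).
  move=> kB; have := fractional_average_le al0 ltr01 (ler0n _ _)
    (window_average_ge0 x k (r k)) (avgK k (r k)).
  rewrite !mulr1 => /(lt_le_trans (Bx _ kB)) h.
  rewrite leNgt; apply/negP => /(gt0_ltr_powR e0).
  rewrite !nnegrE window_average_ge0 (ltW mu0) => /(_ isT isT).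
  rewrite -powRrM mulVf ?gt_eqF // powRr1 ?(ltW lK0) // ltr_pdivlMr ?powR_gt0 //.
  by rewrite mulrC => /(lt_trans h); rewrite ltxx.
(* The sum is a common bound for all [|k| + r k], so the window of radius [L] around 0 contains
   every chosen window. *)
pose L := (\sum_(k <- B) (`|k| + r k))%N.
have kL k : k \in B -> (`|k| + r k <= L)%N by move=> kB; rewrite /L (big_fsetD1 k) //= leq_addr.
set f := fun l : nat => `|x (0 - L%:Z + l%:Z)|.
have weak := @two_sided_maximal_weak _ f L.*2.+1 mu mu0 (fun=> normr_ge0 _).
(* The point [k] of [B] sits at position [k + L], so [B] is covered by the shifted list of selected
   indices. *)
have cardB : #|` B|%:R <= \sum_(i < L.*2.+1 | mu <= two_sided_maximal L.*2.+1 f i) (1 : R).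
  rewrite sumr_const ler_nat.
  set P := [pred i : 'I_L.*2.+1 | mu <= two_sided_maximal L.*2.+1 f i].
  rewrite (_ : #|_| = size [seq (nat_of_ord i)%:Z - L%:Z | i <- enum P]); last by rewrite size_map cardE.
  apply: uniq_leq_size => [|k kB]; first exact: fset_uniq.
  have kn : (`|(k + L%:Z)%R| < L.*2.+1)%N by have := kL _ kB; lia.
  apply/mapP; exists (Ordinal kn) => /=; last by have := kL _ kB; lia.
  rewrite mem_enum inE /=; apply: le_trans (mu_avg _ kB) _.
  have {1}-> : k = 0 - L%:Z + `|(k + L%:Z)%R|%N%:Z by have := kL _ kB; lia.
  by apply: window_average_le_two_sided; have := kL _ kB; lia.
have {}weak : mu * #|` B|%:R <= 4 * K.
  apply: le_trans (ler_wpM2l (ltW mu0) cardB) _; apply: (le_trans weak).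
  by rewrite ler_wpM2l // xK.
have -> : (K / lambda) `^ (1 - alpha)^-1 = K / mu.
  have -> : K / lambda = K `^ (1 - alpha) * (lambda / K `^ alpha)^-1.
    rewrite invf_div mulrA -powRD; last by rewrite subrK oner_eq0.
    by rewrite subrK powRr1 // ltW.
  rewrite powRM ?powR_ge0 ?invr_ge0 ?(ltW lK0) // -powRrM mulfV ?gt_eqF // powRr1 ?(ltW K0) //.
  congr (_ * _); rewrite -(powR_inv1 (ltW lK0)) -(powR_inv1 (ltW mu0)).
  exact: powRAC.
by rewrite mulrA ler_pdivlMr // mulrC.
Qed.

(** An infinite set has finite subsets with more than [b] points, so the hypothesis forces [E] to be
    finite and then applies to [E] itself. *)
Lemma counting_le_fset (R : realType) (T : choiceType) (E : set T) (b : R) :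
  (forall B : {fset T}, [set` B] `<=` E -> #|` B|%:R <= b) ->
  (counting E <= b%:E)%E.
Proof.
move=> Eb; rewrite /counting; case: asboolP => [finE|infE].
  by rewrite lee_fin Eb // fset_setK.
have [B BE cardB] := infinite_set_fset (Num.trunc b).+1 infE.
have := le_lt_trans (Eb B BE) (truncnS_gt b).
by rewrite ltr_nat ltnNge cardB.
Qed.

Lemma counting_frac_maximal_le (R : realType) (alpha K lambda : R) (x : int -> R) :
  0 < alpha -> alpha < 1 -> 0 < lambda ->
  (forall m N, \sum_(i < N.*2.+1) `|x (m - N%:Z + i%:Z)| <= K) ->
  (counting [set k : int | lambda%:E < frac_maximal alpha x k]
    <= (4 * (K / lambda) `^ (1 - alpha)^-1)%:E)%E.
Proof.
move=> al0 al1 l0 xK; apply: counting_le_fset => B BE.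
by apply: weak_type_fset xK _ => // k /BE.
Qed.

(** The sum over all integers is a supremum over finite sets, and windows are among them. *)
Lemma lp1_norm_window_sum (R : realType) (x : int -> R) :
  in_lp 1 x -> exists K, [/\ 0 <= K, lp_norm 1 x = K%:E &
    forall m N, \sum_(i < N.*2.+1) `|x (m - N%:Z + i%:Z)| <= K].
Proof.
have s0 : (0 <= \esum_(k in [set: int]) (`|x k| `^ 1)%:E)%E.
  by apply: esum_ge0 => k _; rewrite lee_fin powR_ge0.
rewrite /in_lp /lp_norm invr1 poweRe1 // => fin.
have xfin : (\esum_(k in [set: int]) (`|x k| `^ 1)%:E)%E \is a fin_num by rewrite ge0_fin_numE.
exists (fine (\esum_(k in [set: int]) (`|x k| `^ 1)%:E)%E).
split=> [||m N]; first exact: fine_ge0; first by rewrite fineK.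
rewrite -lee_fin fineK //; apply: esum_ge; exists (window m N).
  by split => //; exact: finite_window.
rewrite fsumEFin; last exact: finite_window.
by rewrite lee_fin window_sum; under [leRHS]eq_bigr do rewrite powRr1 //.
Qed.
Unset Implicit Arguments.
Set Strict Implicit.

Theorem theorem3p2 (R : realType) (alpha : R) (alpha0 : 0 < alpha)
    (alpha1 : alpha < 1) :
  (forall p q : R, 1 < p -> p <= q -> q < 1 / alpha ->
    let s := p / (1 - alpha * q) in
    let t := q * s / p in
    (forall x : int -> R, in_morrey p q x ->
      (forall m : int, frac_maximal alpha x m \is a fin_num) /\
      in_morrey s t (fine \o frac_maximal alpha x)) /\
    (exists2 C : R, 0 < C &
      forall x : int -> R, in_morrey p q x ->
        (morrey_norm s t (fine \o frac_maximal alpha x)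
          <= C%:E * morrey_norm p q x)%E)) /\
  ((forall x : int -> R, in_lp 1 x ->
      (forall m : int, frac_maximal alpha x m \is a fin_num) /\
      in_weak_lp (1 / (1 - alpha)) (fine \o frac_maximal alpha x)) /\
   (forall lambda : R, 0 < lambda ->
     exists2 C : R, 0 < C &
       forall x : int -> R, in_lp 1 x ->
         (counting [set k : int | lambda%:E < frac_maximal alpha x k]
           <= C%:E * (lp_norm 1 x * (lambda^-1)%:E) `^ (1 / (1 - alpha)))%E)).
Proof.
split=> [p q p1 pq qal s t|].
  have p0 : 0 < p := lt_trans ltr01 p1.
  have q0 : 0 < q := lt_le_trans p0 pq.
  have alq : alpha * q < 1 by rewrite mulrC -ltr_pdivlMr.
  have bound (x : int -> R) : in_morrey p q x ->
      exists K, [/\ 0 <= K, morrey_norm p q x = K%:E &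
        (morrey_norm s t (fine \o frac_maximal alpha x)
          <= (morrey_constant p `^ s^-1 * K)%:E)%E].
    move=> xfin.
    have xfn : morrey_norm p q x \is a fin_num by rewrite ge0_fin_numE ?morrey_norm_ge0.
    have K0 : 0 <= fine (morrey_norm p q x) by rewrite fine_ge0 ?morrey_norm_ge0.
    exists (fine (morrey_norm p q x)); rewrite fineK //; split => //.
    by apply: morrey_norm_frac_maximal_le => //; rewrite fineK.
  split=> [x xfin|].
    have [K [K0 xK MK]] := bound _ xfin; split=> [m|]; last exact: le_lt_trans MK (ltry _).
    apply: (morrey_frac_maximal_fin_num p1 pq K0) => //.
    by apply: morrey_norm_window_sum => //; rewrite xK.
  exists (morrey_constant p `^ s^-1) => [|x xfin]; last first.
    by have [K [_ -> MK]] := bound _ xfin; rewrite -EFinM.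
  (* The summand 1 in [morrey_constant] makes it positive. *)
  by rewrite powR_gt0 // mulr_gt0 ?powR_gt0 // ltr_wpDl // !mulr_ge0 ?powR_ge0.
have e0 : 0 < 1 - alpha by rewrite subr_gt0.
rewrite div1r; split=> [x xfin|lambda l0]; last first.
  (* The constant 4 of [weak_type_fset] serves every level [lambda]. *)
  exists 4 => // x xfin; have [K [K0 -> xK]] := lp1_norm_window_sum xfin.
  by rewrite -(EFinM K) poweR_EFin -EFinM counting_frac_maximal_le.
have [K [K0 _ xK]] := lp1_norm_window_sum xfin.
have Mfin m : frac_maximal alpha x m \is a fin_num.
  rewrite ge0_fin_numE ?frac_maximal_ge0 //.
  by apply: le_lt_trans (frac_maximal_le_sum _ alpha1 xK) (ltry _).
(* At each level, [l * (4 * (K/l)^(1/(1-alpha)))^(1-alpha) = 4^(1-alpha) * K], free of [l]. *)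
split=> //; apply: (@le_lt_trans _ _ (4 `^ (1 - alpha) * K)%:E); last exact: ltry.
apply: ge_ereal_sup => _ /= [l l0 <-]; rewrite invrK.
have -> : [set k | l < `|(fine \o frac_maximal alpha x) k|]
    = [set k | (l%:E < frac_maximal alpha x k)%E].
  apply/seteqP; split => k /=;
    by rewrite ger0_norm ?fine_ge0 ?frac_maximal_ge0 // -lte_fin fineK.
have b := counting_frac_maximal_le alpha0 alpha1 l0 xK.
have c0 (E : set int) : (0 <= counting E :> \bar R)%E.
  by rewrite /counting; case: ifP => // _; rewrite lee_fin.
apply: (@le_trans _ _ (l%:E * (4 * (K / l) `^ (1 - alpha)^-1)%:E `^ (1 - alpha))%E).
  rewrite lee_wpmul2l ?lee_fin ?(ltW l0) // gt0_ler_poweR ?(ltW e0) //.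
    by rewrite in_itv /= c0 leey.
  by rewrite in_itv /= lee_fin leey mulr_ge0 ?powR_ge0.
rewrite poweR_EFin -EFinM lee_fin powRM ?powR_ge0 // -powRrM mulVf ?gt_eqF //.
rewrite powRr1 ?divr_ge0 ?(ltW l0) // mulrCA ler_wpM2l ?powR_ge0 //.
by rewrite mulrC divfK // gt_eqF.
Qed.
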